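(* Let $d\ge 2$ be an integer. Consider any greedy algorithm for $d$-Scattered Set of the following form: starting with all vertices of the input graph $G=(V,E)$ unconsidered and an empty solution, repeatedly choose an unconsidered vertex $v$ (according to any rule, e.g. based on vertex degrees), add $v$ to the solution, and mark $v$ together with all vertices at distance at most $d-1$ from $v$ in $G$ as considered, until no unconsidered vertices remain. Then on graphs of maximum degree at most $\Delta$ such an algorithm achieves approximation ratio $O(\Delta^{\lfloor d/2\rfloor})$, i.e. $OPT_d(G)\le ALG\cdot O(\Delta^{\lfloor d/2\rfloor})$, where $ALG$ is the size of the returned solution.
   Context: All graphs are finite, simple and undirected. $d_G(u,v)$ is the shortest-path distance (number of edges) between $u$ and $v$ in $G$. A $d$-scattered set of $G$ is a set $K\subseteq V$ with $d_G(u,v)\ge d$ for all distinct $u,v\in K$; $OPT_d(G)$ is the maximum size of a $d$-scattered set in $G$. *)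

(* Defs.v *)
From HB Require Import structures.
From mathcomp Require Import all_boot.

Set Implicit Arguments.
Unset Strict Implicit.
Unset Printing Implicit Defensive.

(* A finite simple undirected graph is a finType V of vertices with a symmetric
   irreflexive adjacency relation e : rel V; both conditions are hypotheses of
   the theorem. *)
Section ScatteredSet.

Variables (V : finType) (e : rel V).

Definition has_walk (u v : V) (k : nat) : bool :=
  [exists p : k.-tuple V, path e u p && (last u p == v)].

Lemma connect_has_walk u v : connect e u v -> exists k, has_walk u v k.
Proof.
case/connectP=> p ep ->; exists (size p); apply/existsP.
by exists (in_tuple p); rewrite /= ep eqxx.
Qed.

(* None stands for infinite distance (different components). *)
Definition gdist (u v : V) : option nat :=
  match @idP (connect e u v) with
  | ReflectT uv => Some (ex_minn (connect_has_walk uv))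
  | ReflectF _ => None
  end.

Definition dist_ge (u v : V) (n : nat) : bool :=
  if gdist u v is Some k then n <= k else true.

Definition dist_le (u v : V) (n : nat) : bool :=
  if gdist u v is Some k then k <= n else false.

Definition degree (v : V) : nat := #|[set w | e v w]|.

Definition max_degree : nat := \max_(v : V) degree v.

Definition scattered (d : nat) (K : {set V}) : bool :=
  [forall u in K, forall v in K, (u != v) ==> dist_ge u v d].

Definition OPT (d : nat) : nat := \max_(K : {set V} | scattered d K) #|K|.

(* greedy_state d C S: some sequence of choices leads to the state in which C is
   the set of considered vertices and S the current solution. The choice of the
   unconsidered vertex is unconstrained, so these are the states reachable under
   all selection rules. *)
Inductive greedy_state (d : nat) : {set V} -> {set V} -> Prop :=
| greedy_init : greedy_state d set0 set0
| greedy_choose (C S : {set V}) (v : V) :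
    greedy_state d C S -> v \notin C ->
    greedy_state d (C :|: (v |: [set u | dist_le v u d.-1])) (v |: S).

Definition greedy_output (d : nat) (S : {set V}) : Prop :=
  greedy_state d [set: V] S.

End ScatteredSet.

(* Main.v *)
Require Import Defs.
From mathcomp Require Import all_boot.
From mathcomp Require Import zify.

(** Every vertex lies within distance [d - 1] of some vertex [v] of the greedy
    solution, so it suffices to bound, for a [d]-scattered set [K], the number of
    [u] in [K] with a walk of length at most [d - 1] from [v].  Put
    [h = d %/ 2].  Two vertices of [K] reached in fewer than [h] steps would be at
    distance less than [d], so there is at most one such vertex.  Any other walk
    passes after [h] steps through a midpoint, one of at most [Delta ^ h]
    vertices, and then needs at most [d - 1 - h] further steps; as
    [2 * (d - 1 - h) < d], distinct vertices of [K] have distinct midpoints.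
    This gives [1 + Delta ^ h <= 2 * Delta ^ h] vertices per greedy choice. *)

Lemma leq_card_bigcup (I T : finType) (A : {set I}) (F : I -> {set T}) (m : nat) :
  (forall i, i \in A -> #|F i| <= m) -> #|\bigcup_(i in A) F i| <= #|A| * m.
Proof.
move=> Fm; rewrite -sum_nat_const.
apply: (@leq_trans (\sum_(i in A) #|F i|)); last exact: leq_sum.
apply: (big_ind2 (fun (X : {set T}) n => #|X| <= n)) => [|X m1 Y m2 Xm Ym|//].
  by rewrite cards0.
by apply: leq_trans (leq_card_setU X Y) _; apply: leq_add.
Qed.

Section Walks.

Variables (V : finType) (e : rel V).
Implicit Types (u v w : V) (K S : {set V}).

Lemma has_walkP u v k :
  reflect (exists p : seq V, [/\ size p = k, path e u p & last u p = v])
          (has_walk e u v k).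
Proof.
apply: (iffP existsP) => [[p /andP[ep /eqP lp]]|[p [sp ep lp]]].
  by exists p; rewrite size_tuple.
have sp' : size p == k by apply/eqP.
by exists (Tuple sp'); rewrite /= ep lp eqxx.
Qed.

Lemma has_walk_cat u v w j k :
  has_walk e u v j -> has_walk e v w k -> has_walk e u w (j + k).
Proof.
move=> /has_walkP[p [<- ep lp]] /has_walkP[q [<- eq lq]].
by apply/has_walkP; exists (p ++ q); rewrite size_cat cat_path last_cat ep lp eq.
Qed.

Lemma has_walk_split u w j k :
  has_walk e u w (j + k) ->
  exists2 v, has_walk e u v j & has_walk e v w k.
Proof.
move=> /has_walkP[p [sp ep lp]]; exists (last u (take j p)); apply/has_walkP.
  exists (take j p); split=> //; first by rewrite size_take_min sp; lia.
  by move: ep; rewrite -{1}(cat_take_drop j p) cat_path => /andP[].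
exists (drop j p); split; first by rewrite size_drop sp; lia.
  by move: ep; rewrite -{1}(cat_take_drop j p) cat_path => /andP[].
by rewrite -last_cat cat_take_drop.
Qed.

Lemma has_walk_sym u v k : symmetric e -> has_walk e u v k -> has_walk e v u k.
Proof.
move=> esym /has_walkP[p [<- ep <-]]; apply/has_walkP.
(* The vertices that follow the start of the reversed walk: the old endpoint drops out and [u] comes
   last. *)
exists (rev (belast u p)); split; first by rewrite size_rev size_belast.
  by rewrite rev_path (eq_path (e' := e)) // => x y; rewrite esym.
by case: p {ep} => //= x p; rewrite rev_cons last_rcons.
Qed.

Lemma dist_leP u v n :
  reflect (exists2 k, k <= n & has_walk e u v k) (dist_le e u v n).
Proof.
rewrite /dist_le /gdist; case: {-}_ / idP => [uv|nuv].
  case: ex_minnP => m wm minm; apply: (iffP idP) => [mn|[k kn wk]]; first by exists m.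
  by apply: leq_trans (minm _ wk) kn.
apply: (iffP idP) => // -[k _ /has_walkP[p [_ ep lp]]]; case: nuv.
by apply/connectP; exists p.
Qed.

Lemma dist_ge_walk u v n k : dist_ge e u v n -> has_walk e u v k -> n <= k.
Proof.
rewrite /dist_ge /gdist; case: {-}_ / idP => [uv|nuv].
  by case: ex_minnP => m _ minm nm /minm; apply: leq_trans.
move=> _ /has_walkP[p [_ ep lp]]; case: nuv.
by apply/connectP; exists p.
Qed.

(** Contrapositive form of scatteredness for arbitrary walks, since concatenating two walks only
    bounds a distance from above. *)
Lemma scattered_walk_eq d K u v k :
  scattered e d K -> u \in K -> v \in K -> has_walk e u v k -> k < d -> u = v.
Proof.
move=> /forall_inP scK uK vK wk kd; apply/eqP/negPn/negP => uv.
have /forall_inP/(_ v vK)/implyP/(_ uv) duv := scK u uK.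
by have := dist_ge_walk _ _ _ _ duv wk; rewrite leqNgt kd.
Qed.

(** By induction on [k]: the last step of a walk has at most [Delta] choices. *)
Lemma card_walk_ends Delta v k :
  max_degree e <= Delta -> #|[set w | has_walk e v w k]| <= Delta ^ k.
Proof.
move=> eD; elim: k => [|k IHk].
  rewrite expn0 -(cards1 v); apply/subset_leq_card/subsetP => w.
  by rewrite !inE => /has_walkP[[|x p] [//= _ _ ->]].
have sub : [set w | has_walk e v w k.+1] \subset
    \bigcup_(x in [set w | has_walk e v w k]) [set w | e x w].
  apply/subsetP => w; rewrite inE -addn1 => /has_walk_split[x vx].
  move=> /has_walkP[[|y [|z p]] [//= _ /andP[xy _] yw]].
  by apply/bigcupP; exists x; rewrite inE // -yw.
apply: leq_trans (subset_leq_card sub) _.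
apply: leq_trans (leq_card_bigcup _ _ _ _ Delta _) _.
  by move=> x _; apply: leq_trans eD; apply: leq_bigmax.
by rewrite expnSr leq_mul2r IHk orbT.
Qed.

Lemma card_scattered_ball d Delta K v :
  0 < d -> 0 < Delta -> symmetric e -> max_degree e <= Delta ->
  scattered e d K ->
  #|K :&: [set u | dist_le e v u d.-1]| <= 2 * Delta ^ (d %/ 2).
Proof.
move=> d0 D0 esym eD scK; set h := d %/ 2; set B := _ :&: _.
(* Since [h.-1] is 0 for [h = 0], the conjunct [0 < h] makes the condition mean fewer than [h]
   steps. *)
pose A := [set u in K | dist_le e v u h.-1 && (0 < h)].
(* One midpoint is selected per vertex; [midP] rules out the default [None] on [B :\: A]. *)
pose mid u := [pick w | has_walk e v w h && dist_le e w u (d.-1 - h)].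
have A1 : #|A| <= 1.
  apply/card_le1_eqP => y x.
  rewrite !inE => /and3P[yK /dist_leP[k kh vy] h0] /and3P[xK /dist_leP[j jh vx] _].
  apply: (scattered_walk_eq _ _ _ _ _ scK xK yK).
    exact: has_walk_cat (has_walk_sym _ _ _ esym vx) vy.
  lia.
have midP u : u \in B :\: A ->
    exists w, [/\ mid u = Some w, has_walk e v w h & dist_le e w u (d.-1 - h)].
  rewrite !inE => /andP[uA /andP[uK /dist_leP[k kd vu]]].
  have hk : h <= k.
    rewrite leqNgt; apply/negP => kh; case/negP: uA.
    rewrite uK /=; apply/andP; split; last lia.
    by apply/dist_leP; exists k => //; lia.
  rewrite /mid; case: pickP => [w /andP[vw wu]|no]; first by exists w.
  move: vu; rewrite -(subnKC hk) => /has_walk_split[w vw wu].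
  have := no w; rewrite vw /= => /dist_leP[].
  by exists (k - h) => //; lia.
have mid_inj : {in B :\: A &, injective mid}.
  move=> x y xB yB mxy.
  have [w [mx _ /dist_leP[j jh wx]]] := midP _ xB.
  have [w' [my _ /dist_leP[k kh wy]]] := midP _ yB.
  move: mxy; rewrite mx my => -[ww']; rewrite -ww' in wy.
  have [xK yK] : x \in K /\ y \in K.
    by move: xB yB; rewrite !inE => /andP[_ /andP[-> _]] /andP[_ /andP[-> _]].
  apply: (scattered_walk_eq _ _ _ _ _ scK xK yK).
    exact: has_walk_cat (has_walk_sym _ _ _ esym wx) wy.
  (* Rounding down gives [d - 1 <= 2 * h], so [j + k <= 2 * (d - 1 - h) <= d - 1], also for odd
     [d]. *)
  lia.
have BA : #|B :\: A| <= Delta ^ h.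
  rewrite -(card_in_imset mid_inj); apply: leq_trans (card_walk_ends _ v h eD).
  (* The values of [mid] lie in [option V], so the walk ends are counted through their image under
     [Some]. *)
  rewrite -[leqRHS](card_imset _ (@Some_inj _)).
  apply/subset_leq_card/subsetP => _ /imsetP[u uB ->].
  have [w [-> vw _]] := midP _ uB.
  by apply: imset_f; rewrite inE.
have Dh : 0 < Delta ^ h by rewrite expn_gt0 D0.
rewrite -(cardsID A B).
have := subset_leq_card (subsetIr B A); lia.
Qed.

(** Invariant of the greedy run: vertices become considered only as part of a ball around a chosen
    vertex. At termination [C] is the whole vertex set, so the balls cover the graph. *)
Lemma greedy_state_cover d C S :
  greedy_state e d C S ->
  C \subset \bigcup_(v in S) [set u | dist_le e v u d.-1].
Proof.
elim=> [|{}C {}S v _ IH _]; first exact: sub0set.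
rewrite bigcup_setU big_set1 setUC; apply: setUSS => //.
rewrite subUset subxx andbT sub1set inE; apply/dist_leP; exists 0 => //.
by apply/has_walkP; exists [::].
Qed.

End Walks.

Theorem theorem4 :
  exists c : nat,
    forall (d : nat), 2 <= d ->
    forall (Delta : nat), 1 <= Delta ->
    forall (V : finType) (e : rel V), symmetric e -> irreflexive e ->
    max_degree e <= Delta ->
    forall S : {set V}, greedy_output e d S ->
    OPT e d <= #|S| * (c * Delta ^ (d %/ 2)).
Proof.
exists 2 => d d2 Delta D1 V e esym _ eD S /greedy_state_cover cover.
apply/bigmax_leqP => K scK.
(* [K] is the union of its traces on the balls around [S], and each trace is bounded separately. *)
rewrite -(setIT K); apply: leq_trans (subset_leq_card (setIS K cover)) _.
rewrite big_distrr /=; apply: leq_card_bigcup => v _.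
by apply: card_scattered_ball => //; apply: ltnW.
Qed.
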